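(* Let $p$ be an odd prime, let $m,n$ be positive integers and let $k$ be an integer. Let $G_1$ and $G_2$ be connected graphs of orders $mp$ and $n$, respectively, and suppose that $G_2$ has size $nk$. Let $g_1:V(G_1)\to\{1,2,\ldots,mp\}$ be a bijection, and put $$\varrho_1=\{ab\in E(G_1):([g_1(a)+g_1(b)]/p)=1\},$$ $$\eta_1=\{ab\in E(G_1):([g_1(a)+g_1(b)]/p)=-1\text{ or }g_1(a)+g_1(b)\equiv 0\pmod p\}.$$ If $$|\varrho_1|=|\eta_1|+mk,$$ then the cartesian product graph $G_1\square G_2$ is a Legendre cordial graph modulo $p$.
   Context: All graphs are finite, simple, and connected. The order and size of a graph are its number of vertices and its number of edges, respectively. Cartesian product: $G_1\square G_2$ has vertex set $V(G_1)\times V(G_2)$ and edge set $\{(v_1,u_1)(v_2,u_2): v_1=v_2\text{ and }u_1u_2\in E(G_2),\text{ or }u_1=u_2\text{ and }v_1v_2\in E(G_1)\}$. Legendre symbol: for an odd prime $p$ and an integer $a$ relatively prime to $p$, $(a/p)=1$ if $x^2\equiv a\pmod p$ has a solution and $(a/p)=-1$ otherwise. Legendre cordial labeling: let $p$ be an odd prime and $H$ a simple connected graph of order $N$. A bijection $f:V(H)\to\{1,2,\ldots,N\}$ is a Legendre cordial labeling modulo $p$ if the induced function $f_p^*:E(H)\to\{0,1\}$, defined by $f_p^*(uv)=0$ if $([f(u)+f(v)]/p)=-1$ or $f(u)+f(v)\equiv 0\pmod p$, and $f_p^*(uv)=1$ if $([f(u)+f(v)]/p)=1$, satisfies $|e_{f_p^*}(0)-e_{f_p^*}(1)|\leq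 1$, where $e_{f_p^*}(i)$ is the number of edges with label $i$ ($i=0,1$). A graph admitting such a labeling is called a Legendre cordial graph modulo $p$. *)

(* Defs.v *)
From HB Require Import structures.
From mathcomp Require Import all_boot all_order all_algebra.

Set Implicit Arguments.
Unset Strict Implicit.
Unset Printing Implicit Defensive.

Import Order.TTheory GRing.Theory Num.Theory.

Local Open Scope ring_scope.

Record sgraph := SGraph {
  vertex :> finType;
  adj : rel vertex;
  adj_sym : symmetric adj;
  adj_irrefl : irreflexive adj }.

Definition graph_connected (G : sgraph) : Prop :=
  forall x y : G, connect (@adj G) x y.

(* Edges are unordered pairs, i.e. two-element vertex sets. *)
Definition edges (G : sgraph) : {set {set G}} :=
  [set [set x; y] | x in G, y in G & adj x y].

(* The edges xy satisfying P x y, for P symmetric. *)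
Definition edges_where (G : sgraph) (P : rel G) : {set {set G}} :=
  [set [set x; y] | x in G, y in G & adj x y && P x y].

Definition graph_order (G : sgraph) : nat := #|G|.

Definition graph_size (G : sgraph) : nat := #|edges G|.

Section CartesianProduct.
Variables G1 G2 : sgraph.

Definition cart_adj : rel (G1 * G2) := fun x y =>
  ((x.1 == y.1) && adj x.2 y.2) || ((x.2 == y.2) && adj x.1 y.1).

Lemma cart_adj_sym : symmetric cart_adj.
Proof.
move=> x y; rewrite /cart_adj (eq_sym x.1) (eq_sym x.2).
by rewrite (adj_sym x.1) (adj_sym x.2).
Qed.

Lemma cart_adj_irrefl : irreflexive cart_adj.
Proof. by move=> x; rewrite /cart_adj !adj_irrefl !andbF. Qed.

Definition cart_prod : sgraph := SGraph cart_adj_sym cart_adj_irrefl.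

End CartesianProduct.

(* Solutions of x ^ 2 = a modulo p are sought among the residues 0, ..., p - 1;
   by [square_modP] this loses nothing. *)
Definition square_mod (p : nat) (a : int) : bool :=
  [exists x : 'I_p, (x%:Z ^+ 2 == a %[mod p])%Z].

Lemma square_modP (p : nat) (a : int) : (0 < p)%N ->
  reflect (exists x : int, (x ^+ 2 = a %[mod p])%Z) (square_mod p a).
Proof.
move=> p_gt0; apply: (iffP existsP) => [[x /eqP xa]|[x xa]]; first by exists x%:Z.
have p0 : p%:Z != 0 by rewrite eqz_nat -lt0n.
have xp : (`|(x %% p)%Z| < p)%N.
  by rewrite -ltz_nat gez0_abs ?modz_ge0 // ltz_mod.
exists (Ordinal xp); rewrite /= gez0_abs ?modz_ge0 //.
by rewrite modzXm xa.
Qed.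

(* Only meaningful for p an odd prime. The usual value 0 is given when p divides
   a, so that the values 1 and -1 are taken only at a coprime to p. *)
Definition legendre (p : nat) (a : int) : int :=
  if (p %| a)%Z then 0 else if square_mod p a then 1 else -1.

(* f is a bijection from T onto {1, ..., N}. *)
Definition bijective_onto_1N (T : finType) (f : T -> nat) (N : nat) : Prop :=
  injective f /\ (forall i : nat, (exists v : T, f v = i) <-> (1 <= i <= N)%N).

Section LegendreCordial.
Variables (p : nat) (G : sgraph) (f : G -> nat).

(* The induced label of the edge uv, symmetric in u and v. *)
Definition edge_label (u v : G) : nat :=
  if (legendre p (f u + f v)%N == -1) || (f u + f v == 0 %[mod p])%N
  then 0%N else 1%N.

Lemma edge_label_eq1 (u v : G) :
  (edge_label u v == 1%N) = (legendre p (f u + f v)%N == 1).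
Proof.
rewrite /edge_label /legendre mod0n -/(dvdn p (f u + f v)) dvdzE /=.
by case: (dvdn _ _) => //; case: (square_mod _ _).
Qed.

Definition edges_labeled (i : nat) : {set {set G}} :=
  edges_where (fun u v => edge_label u v == i).

Definition legendre_cordial_labeling : Prop :=
  bijective_onto_1N f (graph_order G) /\
  `|#|edges_labeled 0|%:Z - #|edges_labeled 1|%:Z| <= 1.

End LegendreCordial.

Definition legendre_cordial (p : nat) (G : sgraph) : Prop :=
  graph_connected G /\ exists f : G -> nat, legendre_cordial_labeling p f.

Definition rho_edges (p : nat) (G : sgraph) (g : G -> nat) : {set {set G}} :=
  edges_where (fun a b : G => legendre p (g a + g b)%N == 1).

Definition eta_edges (p : nat) (G : sgraph) (g : G -> nat) : {set {set G}} :=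
  edges_where (fun a b : G =>
    (legendre p (g a + g b)%N == -1)
    || (g a + g b == 0 %[mod p])%N).

(* Main.v *)
Require Import Defs.
From mathcomp Require Import all_boot all_order all_algebra.
From mathcomp Require Import zify.

Set Implicit Arguments.
Unset Strict Implicit.
Unset Printing Implicit Defensive.

Import Order.TTheory GRing.Theory Num.Theory.

Local Open Scope ring_scope.

(** Label the vertex (a, u) of the product by g1 a + m p r, where r < n is the
    rank of u in an enumeration of G2. Modulo p this label is just g1 a, so
    whether an edge is labeled 1 or 0 depends on the G1-coordinates of its ends
    only. Give an edge the sign +1 if its label is 1 and -1 if it is 0; the
    claim is that the signs of all edges add up to 0.

    The edges of the product split into two kinds.

    - Each vertex u of G2 carries a copy of G1 with the signs that g1 induces,
      hence with sign sum |rho| - |eta| = m k. Altogether: n m k.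
    - Each edge uv of G2 gives, for every vertex a of G1, an edge whose sign is
      that of 2 g1 a. As g1 takes the values 1, ..., mp, every residue is met
      m times, and doubling permutes the residues because p is odd. So the sign
      sum is m times the sum over all residues x of the sign of x. There are as
      many nonzero squares as nonsquares, and the residue 0 has sign -1, so
      the inner sum is -1 and the edge uv contributes -m
      ([sum_sign_double_label]). The n k edges of G2 contribute -(n m k).

    So the two kinds cancel exactly. The bookkeeping is done with ordered pairs
    of adjacent vertices (darts): each edge is counted twice, and sums over
    darts of the product decompose coordinatewise ([sum_cart_darts]). *)

(** * Counting edges through darts *)

Lemma eq_set2 (T : finType) (x y a b : T) : x != y ->
  ([set a; b] == [set x; y]) = ((a, b) \in [set (x, y); (y, x)]).
Proof.
move=> xy; rewrite !inE !xpair_eqE; apply/eqP/orP; last first.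
  by case=> /andP[/eqP-> /eqP->] //; rewrite setUC.
move=> /setP E; have := (E a, E b); have := (E x, E y); rewrite !inE !eqxx !orbT /=.
case=> Ex Ey [/esym/orP[]/eqP ax /esym/orP[]/eqP bx]; subst a b; rewrite !eqxx;
  by [left | right | rewrite orbb (negPf xy) in Ex | rewrite orbb eq_sym (negPf xy) in Ey].
Qed.

(** Every edge, being a two-element set, is carried by exactly two darts (x, y)
    and (y, x), and these agree on P by symmetry. *)
Lemma sum_darts (G : sgraph) (P : rel G) : symmetric P ->
  (\sum_(x : G) \sum_(y | adj x y) P x y = 2 * #|edges_where P|)%N.
Proof.
move=> P_sym; pose D := [pred d : G * G | adj d.1 d.2 && P d.1 d.2].
have -> : (\sum_(x : G) \sum_(y | adj x y) P x y = \sum_(d | D d) 1)%N.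
  rewrite pair_big_dep /= [LHS]big_mkcond [RHS]big_mkcond.
  by apply: eq_bigr => -[x y] _ /=; case: (adj x y); case: (P x y).
rewrite (partition_big (fun d => [set d.1; d.2]) (mem (edges_where P))) /=; last first.
  by case=> x y /= xy; apply/imset2P; exists x y; rewrite ?inE.
rewrite mulnC -sum_nat_const; apply: eq_bigr => e /imset2P[x y _].
rewrite inE => /andP[_ /andP[xy Pxy]] ->{e}.
have x_neq_y : x != y by apply: contraTneq xy => ->; rewrite adj_irrefl.
have <- : #|[set (x, y); (y, x)]| = 2%N.
  by rewrite cards2 xpair_eqE (negPf x_neq_y).
rewrite -sum1_card; apply: eq_bigl => -[a b] /=; rewrite eq_set2 //.
apply: andb_idl; rewrite !inE => /orP[] /eqP[-> ->]; first by rewrite xy.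
by rewrite adj_sym P_sym xy.
Qed.

Lemma eq_edges_where (G : sgraph) (P Q : rel G) : P =2 Q ->
  edges_where P = edges_where Q.
Proof.
move=> PQ; apply/setP => e; apply/imset2P/imset2P => -[x y xG];
  by rewrite inE => xy ->; exists x y; rewrite // inE ?PQ // -PQ.
Qed.

Lemma double_graph_size (G : sgraph) :
  (2 * graph_size G = \sum_(x : G) \sum_(y | adj x y) 1)%N.
Proof.
rewrite (sum_darts (P := fun _ _ => true)) // /graph_size.
suff -> : edges G = edges_where (fun _ _ => true) by [].
apply/setP => e; apply/imset2P/imset2P => -[x y xG]; rewrite inE ?andbT => xy ->;
  by exists x y; rewrite // inE ?andbT.
Qed.

(** * The sign of an edge *)

(** This is the Legendre symbol except that multiples of p get -1, because the
    edges whose label sum is divisible by p count as edges of label 0. *)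
Definition residue_sign (p s : nat) : int :=
  if legendre p s == 1 then 1 else -1.

Lemma eta_condE (p s : nat) :
  ((legendre p s == -1) || (s == 0 %[mod p])%N) = (legendre p s != 1).
Proof.
rewrite /legendre mod0n -/(dvdn p s) dvdzE /=.
by case: (dvdn _ _) => //; case: (square_mod _ _).
Qed.

Lemma sum_darts_sign (p : nat) (G : sgraph) (f : G -> nat) :
  \sum_(x : G) \sum_(y | adj x y) residue_sign p (f x + f y)
    = 2 * (#|rho_edges p f|%:Z - #|eta_edges p f|%:Z).
Proof.
rewrite mulrBr -!(PoszM 2%N) -!sum_darts.
- rewrite -!natz !natr_sum -sumrB; apply: eq_bigr => x _.
  rewrite !natr_sum -sumrB; apply: eq_bigr => y _.
  by rewrite eta_condE /residue_sign; case: ifP.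
- by move=> x y; rewrite addnC.
by move=> x y; rewrite addnC.
Qed.

Lemma legendre_modn (p s : nat) : legendre p (s %% p)%N = legendre p s.
Proof.
rewrite /legendre !dvdzE /= /dvdn modn_mod.
have -> : square_mod p (s %% p)%N = square_mod p s.
  by apply: eq_existsb => x; rewrite -modz_nat modz_mod.
by [].
Qed.

Lemma residue_sign_eqmod (p s t : nat) : s = t %[mod p] ->
  residue_sign p s = residue_sign p t.
Proof. by move=> st; rewrite /residue_sign -legendre_modn st legendre_modn. Qed.

(** * The sum of the signs over all residues *)

Lemma eqFp_nat (p a b : nat) : prime p ->
  (a%:R == b%:R :> 'F_p) = (a == b %[mod p])%N.
Proof. by move=> p_prime; rewrite -val_eqE /= !val_Fp_nat. Qed.

Lemma square_modE (p s : nat) : prime p ->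
  square_mod p s = [exists y : 'F_p, y ^+ 2 == s%:R].
Proof.
move=> p_prime.
have sqE (i : nat) : (i%:Z ^+ 2 == s %[mod p])%Z = (i%:R ^+ 2 == s%:R :> 'F_p).
  by rewrite -natrX eqFp_nat // -[i%:Z ^+ 2]/(i * i)%N%:Z !modz_nat.
apply/existsP/existsP => [[i]|[y]].
  by rewrite sqE => ?; exists i%:R.
have y_lt : (y < p)%N by rewrite -[X in (_ < X)%N](Fp_cast p_prime).
by exists (Ordinal y_lt); rewrite sqE /= natr_Zp.
Qed.

Lemma Fp_two_neq0 (p : nat) : prime p -> odd p -> 2%:R != 0 :> 'F_p.
Proof.
move=> p_prime p_odd; rewrite -[0]/(0%:R) eqFp_nat // mod0n -/(dvdn p 2) dvdn_prime2 //.
by case: eqP => // p2; rewrite p2 in p_odd.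
Qed.

(** The number of square roots of s in the prime field is 1, 2 or 0 according
    to s being zero, a nonzero square or a nonsquare. It replaces a count of
    the squares below, as its sum over all s is the number of elements of the
    field. *)
Lemma residue_signE (p s : nat) : prime p -> odd p ->
  residue_sign p s
    = #|[set y : 'F_p | y ^+ 2 == s%:R]|%:Z - 1 - (s%:R == 0 :> 'F_p)%:Z.
Proof.
move=> p_prime p_odd; rewrite /residue_sign /legendre dvdzE /=.
have -> : (p %| s)%N = (s%:R == 0 :> 'F_p).
  by rewrite -[0]/(0%:R) eqFp_nat // mod0n.
have [->|s0] := eqVneq (s%:R : 'F_p) 0.
  rewrite (_ : [set y | _] = [set 0]) ?cards1 //.
  by apply/setP => y; rewrite !inE sqrf_eq0.
rewrite square_modE //; case: existsP => [[y /eqP ys]|no_root].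
  rewrite (_ : [set y | _] = [set y; - y]).
    have y0 : y != 0 by apply: contraNneq s0 => y0; rewrite -ys y0 expr0n.
    rewrite cards2 -addr_eq0 -mulr2n -mulr_natr mulf_eq0.
    by rewrite (negPf y0) (negPf (Fp_two_neq0 p_prime p_odd)).
  by apply/setP => z; rewrite !inE -ys eqf_sqr.
rewrite (_ : [set y | _] = set0) ?cards0 //.
by apply/setP => y; rewrite !inE; apply/negP => ys; apply: no_root; exists y.
Qed.

(** Doubling permutes the field, and each y is a square root of exactly one
    element, so the square root counts contribute p to the sum, against
    p + 1 from the two other terms of [residue_signE]. *)
Lemma sum_residue_sign_double (p : nat) : prime p -> odd p ->
  \sum_(i < p) residue_sign p (i + i) = -1.
Proof.
move=> p_prime p_odd.
have two0 := Fp_two_neq0 p_prime p_odd.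
pose H (x : 'F_p) := #|[set y : 'F_p | y ^+ 2 == x]|%:Z - 1 - (x == 0)%:Z.
have -> : \sum_(i < p) residue_sign p (i + i) = \sum_(x : 'F_p) H (2%:R * x).
  (* The carrier of 'F_p is an ordinal type whose bound equals p only
     propositionally, so the index type is changed through a sum over nat. *)
  rewrite -[in LHS](big_mkord predT (fun i => residue_sign p (i + i))).
  rewrite -[X in index_iota _ X](Fp_cast p_prime) big_mkord.
  apply: eq_bigr => x _; rewrite residue_signE // /H.
  by rewrite -[x in 2%:R * x]natr_Zp -natrM mul2n addnn.
have double_bij : {on [pred x : 'F_p | true], bijective ( *%R (2%:R : 'F_p))}.
  by exists ( *%R (2%:R^-1)) => x _; rewrite ?mulKf ?mulVKf.
rewrite -(reindex _ double_bij) /= /H !sumrB.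
rewrite [X in _ - X](_ : _ = 1); last first.
  by rewrite (bigD1 0) //= big1 ?addr0 // => x /negPf->.
suff -> : \sum_(x : 'F_p) #|[set y : 'F_p | y ^+ 2 == x]|%:Z = \sum_(x : 'F_p) 1.
  by rewrite subrr.
under eq_bigr => x _ do rewrite -sum1_card -natz natr_sum big_mkcond.
rewrite exchange_big; apply: eq_bigr => y _.
rewrite (bigD1 (y ^+ 2)) //= inE eqxx big1 ?addr0 // => x /negPf xy.
by rewrite inE eq_sym xy.
Qed.

(** * Labels modulo p *)

Lemma sum_bijective_onto_1N (T : finType) (g : T -> nat) (N : nat) (F : nat -> int) :
  bijective_onto_1N g N -> \sum_x F (g x) = \sum_(i < N) F i.+1.
Proof.
case=> g_inj g_onto.
rewrite -[in RHS](big_mkord predT (fun i => F i.+1)) -[RHS](big_add1 _ _ 0 N.+1 predT F).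
rewrite -(big_map g predT F); apply: perm_big; apply: uniq_perm.
- by rewrite map_inj_uniq ?index_enum_uniq.
- exact: iota_uniq.
move=> i; rewrite mem_index_iota ltnS; apply/mapP/idP => [[x _ ->]|/g_onto[x <-]].
  by apply/g_onto; exists x.
by exists x; rewrite ?mem_index_enum.
Qed.

Lemma sum_periodic (p m : nat) (F : nat -> int) :
    (forall i, F (i + p)%N = F i) ->
  \sum_(i < m * p) F i = m%:Z * \sum_(i < p) F i.
Proof.
move=> F_per; elim: m => [|m IHm]; first by rewrite big_ord0 mul0r.
rewrite mulSnr big_split_ord /= IHm intS mulrDl mul1r addrC; congr (_ + _).
apply: eq_bigr => i _; elim: m {IHm} => [|m IHm] //.
by rewrite mulSnr addnAC F_per.
Qed.

Lemma sum_sign_double_label (p m : nat) (T : finType) (g : T -> nat) :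
    prime p -> odd p -> bijective_onto_1N g (m * p)%N ->
  \sum_x residue_sign p (g x + g x) = - m%:Z.
Proof.
move=> p_prime p_odd g_bij; pose F i := residue_sign p (i + i).
have F_per i : F (i + p)%N = F i.
  by apply: residue_sign_eqmod; rewrite addnACA addnA !modnDr.
rewrite (sum_bijective_onto_1N F g_bij) (@sum_periodic _ _ (fun i => F i.+1)) => [|i].
  (* The labels start at 1, but a full period of F has the same sum wherever
     it starts. *)
  have -> : \sum_(i < p) F i.+1 = \sum_(i < p) F i.
    have rot : F 0%N + \sum_(i < p) F i.+1 = \sum_(i < p.+1) F i by rewrite big_ord_recl.
    apply: (addrI (F 0%N)); rewrite rot big_ord_recr /= addrC.
    by rewrite (F_per 0%N : F p = F 0%N).
  by rewrite sum_residue_sign_double // mulrN1.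
by rewrite -addSn F_per.
Qed.

(** * The cartesian product *)

Lemma connect_homo (S T : finType) (e : rel S) (e' : rel T) (h : S -> T) :
    (forall x y, e x y -> e' (h x) (h y)) ->
  forall x y, connect e x y -> connect e' (h x) (h y).
Proof.
move=> he x y /connectP[s + ->] {y}; elim: s x => //= z s IHs x /andP[xz zs].
by apply: connect_trans (IHs _ zs); apply/connect1/he.
Qed.

Lemma cart_connected (G1 G2 : sgraph) :
  graph_connected G1 -> graph_connected G2 -> graph_connected (cart_prod G1 G2).
Proof.
move=> con1 con2 [a u] [b v]; apply: (@connect_trans _ _ (b, u)).
  apply: (connect_homo (h := fun c : G1 => (c, u)) _ (con1 a b)) => x y xy.
  by rewrite /= /cart_adj /= eqxx xy orbT.
apply: (connect_homo (h := fun w : G2 => (b, w)) _ (con2 u v)) => x y xy.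
by rewrite /= /cart_adj /= eqxx xy.
Qed.

(** Division with remainder by M, with remainders taken in 1, ..., M: the rank
    of the second coordinate is the quotient and g gives the remainder. *)
Lemma bijective_onto_1N_prod (S T : finType) (g : S -> nat) (M : nat) :
    bijective_onto_1N g M ->
  bijective_onto_1N (fun x : S * T => g x.1 + M * enum_rank x.2)%N (M * #|T|)%N.
Proof.
case=> g_inj g_onto.
have g_range a : (1 <= g a <= M)%N by apply/g_onto; exists a.
have digits_inj (c d x y : nat) :
    (1 <= c <= M)%N -> (1 <= d <= M)%N -> (c + M * x = d + M * y)%N -> x = y.
  move=> /andP[c1 cM] /andP[d1 dM] E.
  by case: (ltngtP x y) => // lt; have := leq_mul (leqnn M) lt; rewrite mulnS; lia.
split=> [[a u] [b v] /= E|i].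
  have uv := digits_inj _ _ _ _ (g_range a) (g_range b) E.
  suff [-> ->] : a = b /\ u = v by [].
  split; last exact/enum_rank_inj/val_inj.
  by apply: g_inj; rewrite uv in E; exact: addIn E.
split=> [[[a u] /= <-]|/andP[i1 iN]].
  have /andP[a1 aM] := g_range a; have u_lt : (enum_rank u < #|T|)%N := ltn_ord _.
  rewrite ltn_addr //=; apply: leq_trans (leq_mul (leqnn M) u_lt).
  by rewrite mulnS leq_add2r.
have M_gt0 : (0 < M)%N by case: (posnP M) => // M0; rewrite M0 in iN; lia.
have q_lt : (i.-1 %/ M < #|T|)%N by rewrite ltn_divLR //; lia.
have [|a ga] := (g_onto (i.-1 %% M).+1).2; first by rewrite ltn_mod.
exists (a, enum_val (Ordinal q_lt)); rewrite /= enum_valK ga /=.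
have := divn_eq i.-1 M; lia.
Qed.

(** A dart of the product moves in exactly one coordinate. Darts that move in G2
    keep the first coordinate a and see the diagonal value W a a; darts that
    move in G1 repeat the sum over G1 once for each vertex of G2. *)
Lemma sum_cart_darts (G1 G2 : sgraph) (W : G1 -> G1 -> int) :
  \sum_(x : cart_prod G1 G2) \sum_(y | adj x y) W x.1 y.1
    = (\sum_a W a a) * (2 * (graph_size G2)%:Z)
      + #|G2|%:Z * (\sum_a \sum_(b | adj a b) W a b).
Proof.
have split_adj (x : cart_prod G1 G2) : \sum_(y | adj x y) W x.1 y.1 =
    \sum_(v | adj x.2 v) W x.1 x.1 + \sum_(b | adj x.1 b) W x.1 b.
  case: x => a u /=; rewrite big_mkcond /=.
  (* No loops: the two clauses of adjacency exclude each other. *)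
  rewrite (eq_bigr (fun y : G1 * G2 =>
      (if (y.1 == a) && adj u y.2 then W a a else 0)
      + (if (y.2 == u) && adj a y.1 then W a y.1 else 0))); last first.
    case=> b v _; rewrite /cart_adj /= (eq_sym a) (eq_sym u).
    have [->|] := eqVneq b a; have [->|] := eqVneq v u; rewrite ?adj_irrefl ?orbF /=.
    - by rewrite addr0.
    - by rewrite addr0.
    - by rewrite add0r.
    by rewrite addr0.
  rewrite big_split /= -!big_mkcond; congr (_ + _).
    rewrite -(pair_big (pred1 a) (fun v => adj u v) (fun _ _ => W a a)) /=.
    by rewrite big_pred1_eq.
  rewrite -(pair_big_dep predT (fun b v => (v == u) && adj a b) (fun b _ => W a b)) /=.
  rewrite [RHS]big_mkcond; apply: eq_bigr => b _.
  by case: (adj a b); [rewrite big_mkcondr big_pred1_eq | rewrite big_pred0 // => v; rewrite andbF].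
rewrite (eq_bigr _ (fun x _ => split_adj x)) big_split /=; congr (_ + _).
  rewrite -(pair_bigA _ (fun a u => \sum_(v : G2 | adj u v) W a a)) /= mulr_suml.
  apply: eq_bigr => a _; rewrite -(PoszM 2) double_graph_size -natz natr_sum mulr_sumr.
  apply: eq_bigr => u _; rewrite natr_sum mulr_sumr.
  by apply: eq_bigr => v _; rewrite mulr1.
rewrite -(pair_bigA _ (fun a u => \sum_(b | adj a b) W a b)) /= mulr_sumr.
by apply: eq_bigr => a _; rewrite sumr_const -mulr_natl natz.
Qed.

Theorem theorem3p6 (p m n : nat) (k : int) (G1 G2 : sgraph) (g1 : G1 -> nat)
  (p_prime : prime p) (p_odd : odd p) (m_gt0 : (0 < m)%N) (n_gt0 : (0 < n)%N)
  (G1_connected : graph_connected G1) (G2_connected : graph_connected G2)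
  (G1_order : graph_order G1 = (m * p)%N) (G2_order : graph_order G2 = n)
  (G2_size : (graph_size G2)%:Z = n%:Z * k)
  (g1_bij : bijective_onto_1N g1 (m * p)%N)
  (rho_eta : #|rho_edges p g1|%:Z = #|eta_edges p g1|%:Z + m%:Z * k) :
  legendre_cordial p (cart_prod G1 G2).
Proof.
split; first exact: cart_connected.
pose f (x : cart_prod G1 G2) := (g1 x.1 + m * p * enum_rank x.2)%N.
exists f; split.
  have -> : graph_order (cart_prod G1 G2) = (m * p * #|G2|)%N.
    by rewrite -G1_order; exact: card_prod.
  exact: bijective_onto_1N_prod.
have -> : edges_labeled p f 1 = rho_edges p f.
  by apply: eq_edges_where => x y; exact: edge_label_eq1.
have -> : edges_labeled p f 0 = eta_edges p f.
  by apply: eq_edges_where => x y; rewrite /edge_label; case: ifP.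
suff : #|rho_edges p f|%:Z - #|eta_edges p f|%:Z = 0 by lia.
have f_mod x y : residue_sign p (f x + f y) = residue_sign p (g1 x.1 + g1 y.1).
  apply: residue_sign_eqmod; rewrite /f addnACA -mulnDr -mulnA mulnCA mulnC.
  by rewrite addnC modnMDl.
(* The sign sum of the product, doubled, is evaluated in two ways. *)
have := sum_darts_sign p f.
under eq_bigr => x _ do under eq_bigr => y _ do rewrite f_mod.
rewrite (sum_cart_darts _ (fun a b => residue_sign p (g1 a + g1 b))).
rewrite (sum_sign_double_label p_prime p_odd g1_bij) sum_darts_sign rho_eta G2_size.
rewrite (G2_order : #|G2| = n); nia.
Qed.
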